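(* Let $n$ be a positive integer and let $A_n$ be the $n\times n$ matrix with entries $(A_n)_{ij}=(j-i)^2$. Then there exists an entrywise non-negative $n\times 3$ real matrix $L_n$ such that $A_n = L_n R L_n^T$, where $$R=\begin{pmatrix} 0 & 1 & 1\\ 1 & -6 & 1\\ 1 & 1 & 0\end{pmatrix}.$$
   Context: $A_n$ is the Euclidean distance matrix of $\{1,2,\ldots,n\}$. *)

(* Defs.v *)
(* MathComp world; the real numbers are an arbitrary R : realType. *)
From HB Require Import structures.
From mathcomp Require Import all_boot all_order all_algebra.
From mathcomp Require Import reals.

Set Implicit Arguments.
Unset Strict Implicit.
Unset Printing Implicit Defensive.

Import Order.TTheory GRing.Theory Num.Theory.
Local Open Scope ring_scope.

(* The index i : 'I_n stands for the point i.+1 of {1, ..., n}. The subtraction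
   takes place in R, not in nat. *)
Definition edm_mx (R : realType) (n : nat) : 'M[R]_n :=
  \matrix_(i < n, j < n) ((j.+1)%:R - (i.+1)%:R) ^+ 2.

Definition R_mx (R : realType) : 'M[R]_3 :=
  \matrix_(i < 3, j < 3)
    nth 0 (nth [::] [:: [:: 0;  1; 1];
                        [:: 1; -6; 1];
                        [:: 1;  1; 0]] i) j.

(* Main.v *)
Require Import Defs.
From HB Require Import structures.
From mathcomp Require Import all_boot all_order all_algebra.
From mathcomp Require Import reals.
From mathcomp Require Import ring.

(** The matrix [R_mx R] is the Gram matrix of a bilinear form [B] on [R ^ 3],
    and the rows of [L] must be non-negative vectors [l_i] such that
    [B l_i l_j = (j - i) ^ 2]; in particular they lie on the conic
    [B l l = 0], that is [ab + bc + ac = 3 b ^ 2].  In the chart [b = 1] this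
    conic is the hyperbola [(a + 1)(c + 1) = 4], which is parametrized, up to
    scaling, by
      [l(p, q) = (p (2p - q), p q, q (2q - p))].
    A form restricted to the conic where it vanishes becomes the square of a
    determinant in such a parametrization:
      [B (l(p, q)) (l(p', q')) = 4 (p q' - p' q) ^ 2].
    It remains to choose [p, q] affine in [t] so that this determinant is
    [(t' - t) / 2] up to sign and [l(p, q)] is non-negative.  In the
    coordinates [x = 2p - q], [y = 2q - p], for which [p = (2x + y) / 3] and
    [q = (x + 2y) / 3], non-negativity follows from [x, y >= 0], and
    [x y' - x' y = 3 (p q' - p' q)].  So [x = t] and [y = 3 / 2] do the job
    for all [t >= 0] at once. *)

Set Implicit Arguments.
Unset Strict Implicit.
Unset Printing Implicit Defensive.

Import Order.TTheory GRing.Theory Num.Theory.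
Local Open Scope ring_scope.

(** The point [(p x, p q, q y)] of the conic, for [x = t], [y = 3 / 2],
    [p = (4t + 3) / 6] and [q = (t + 3) / 3]. *)
Definition conic_point (F : fieldType) (t : F) : seq F :=
  [:: t * (4 * t + 3) / 6; (4 * t + 3) * (t + 3) / 18; (t + 3) / 2].

Lemma conic_point_ge0 (F : numFieldType) (t : F) (k : nat) :
  0 <= t -> 0 <= (conic_point t)`_k.
Proof.
move=> t_ge0; case: k => [|[|[|k]]] /=; last by rewrite nth_nil.
- by rewrite divr_ge0 ?mulr_ge0 ?addr_ge0 ?mulr_ge0.
- by rewrite divr_ge0 ?mulr_ge0 ?addr_ge0 ?mulr_ge0.
- by rewrite divr_ge0 ?addr_ge0.
Qed.

Lemma R_mx_congrE (R : realType) (n : nat) (L : 'M[R]_(n, 3)) (i j : 'I_n)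
    (l m : seq R) :
  (forall k : 'I_3, L i k = l`_k) -> (forall k : 'I_3, L j k = m`_k) ->
  (L *m R_mx R *m L^T) i j =
    l`_0 * (m`_1 + m`_2) + l`_1 * (m`_0 - 6 * m`_1 + m`_2)
      + l`_2 * (m`_0 + m`_1).
Proof.
move=> Li Lj; rewrite mxE !big_ord_recl big_ord0 !mxE !big_ord_recl !big_ord0.
rewrite !mxE !Li !Lj /=.
by ring.
Qed.

Theorem theorem2 (R : realType) (n : nat) (n_gt0 : (0 < n)%N) :
  exists L : 'M[R]_(n, 3),
    (forall (i : 'I_n) (k : 'I_3), 0 <= L i k) /\
    edm_mx R n = L *m R_mx R *m L^T.
Proof.
exists (\matrix_(i < n, k < 3) (conic_point (i%:R : R))`_k); split=> [i k|].
  by rewrite mxE conic_point_ge0.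
apply/matrixP=> i j.
rewrite (R_mx_congrE (l := conic_point i%:R) (m := conic_point j%:R));
  try by move=> k; rewrite mxE.
rewrite mxE -!natr1 /=.
by field.
Qed.
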